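(* For every $k$, the set $S(P_k)$ is inhabited, so that the recursive clause defining the sieve states has a least element $r_k=\min S(P_k)$. This least survivor is prime. Moreover, $P_k$ is exactly the set of the first $k$ ordinary primes, and $r_k$ is the $(k+1)$st ordinary prime.
   Context: $\mathbb{N}_{>1}$ is the set of integers greater than $1$. For a finite set $P\subseteq\mathbb{N}_{>1}$ put $C(P)=\bigcup_{p\in P}p\,\mathbb{N}_{>1}$ (all products $pb$ with $p\in P$, $b>1$) and $S(P)=\mathbb{N}_{>1}\setminus(P\cup C(P))$. The sieve states are defined recursively for $k\in\mathbb{N}$ by $P_0=\varnothing$, $r_k=\min S(P_k)$, $P_{k+1}=P_k\cup\{r_k\}$. A number $n$ is prime if $n>1$ and there are no $a,b>1$ with $ab=n$. *)

(* Defs.v *)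
From mathcomp Require Import all_boot all_order finmap.
From mathcomp Require Import mathcomp_extra boolp classical_sets.

Set Implicit Arguments.
Unset Strict Implicit.
Unset Printing Implicit Defensive.

Local Open Scope classical_set_scope.
Local Open Scope nat_scope.

Definition Ngt1 : set nat := [set n | 1 < n].

Definition multiples (P : {fset nat}) : set nat :=
  \bigcup_(p in [set` P]) [set p * b | b in Ngt1].

Definition survivors (P : {fset nat}) : set nat := Ngt1 `\` ([set` P] `|` multiples P).

(* The junk value 0 is taken when A has no least element, i.e. when A is
   empty. *)
Definition set_min (A : set nat) : nat := xget 0 (A `&` lbound A).

Fixpoint sieve (k : nat) : {fset nat} :=
  if k is k'.+1 then (sieve k' `|` [fset set_min (survivors (sieve k'))])%fset
  else fset0.

Definition least_survivor (k : nat) : nat := set_min (survivors (sieve k)).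

(* The boolean [prime] agrees with the definition by absence of proper
   factorizations. *)
Lemma primeNfactor (n : nat) :
  prime n <-> 1 < n /\ ~ exists a b, [/\ 1 < a, 1 < b & a * b = n].
Proof.
split=> [pn|[n1 nf]].
  split; first exact: prime_gt1.
  move=> [a [b [a1 b1 abn]]]; have /primeP[_ /(_ a)] := pn.
  rewrite -abn dvdn_mulr// => /(_ isT)/orP[/eqP a1'|/eqP aab].
    by rewrite a1' in a1.
  have : a * 1 < a * b by rewrite ltn_pmul2l// (ltn_trans _ a1).
  by rewrite -aab muln1 ltnn.
apply/primeP; split=> // d /dvdnP[q nqd]; apply/negP => /negP.
rewrite negb_or => /andP[d1 dn]; apply: nf; exists q, d; split=> //.
- case: q nqd => [|[|q]] // nqd; first by rewrite nqd in n1.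
  by rewrite nqd mul1n eqxx in dn.
- by case: d nqd d1 dn => [|[|d]] // nqd; rewrite nqd muln0 in n1.
Qed.

(* Exactly k primes, forming an initial segment of the primes. *)
Definition first_primes (k : nat) (A : {fset nat}) : Prop :=
  [/\ #|` A| = k,
      forall p, p \in A -> prime p
    & forall p q, p \in A -> prime q -> q < p -> q \in A].

(* The counting of primes starts at 1: p is the prime for which exactly k
   primes are at most p, so nth_prime 1 2 holds. *)
Definition nth_prime (k p : nat) : Prop :=
  prime p /\ count prime (iota 0 p.+1) = k.

(* Main.v *)
Require Import Defs.
From mathcomp Require Import all_boot all_order finmap.
From mathcomp Require Import mathcomp_extra boolp classical_sets.

(** The sieve works because, for a finite set [P] of primes, the least
    survivor of [P] is the least prime outside [P].  On one hand a prime outside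
    [P] survives, since it is not a proper multiple of any number
    greater than 1 ([prime_survivor]); by the infinitude of primes there is always a survivor.
    On the other hand no survivor [n] has its least prime factor in [P]
    ([survivor_pdiv]), so [pdiv n <= n] is itself a survivor, and the minimal
    [n] must be equal to it.

    Consequently, if [P] is an initial segment of the primes with [k]
    elements, then adding the least survivor [r] gives an initial segment with
    [k.+1] elements, whose largest element is [r].  Induction on [k] shows that
    the sieve states are the initial segments of the primes, and the position
    of [r] among the primes is the cardinality of the new segment
    ([count_first_primes]). *)

Local Open Scope classical_set_scope.
Local Open Scope nat_scope.

Lemma set_minP (A : set nat) : A !=set0 ->
  A (set_min A) /\ forall n, A n -> set_min A <= n.
Proof.
move=> [n An].
have exA : exists m, `[< A m >] by exists n; apply/asboolP.
have [m /asboolP Am minm] := ex_minnP exA.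
have : (A `&` lbound A) (set_min A).
  apply: (@xgetI _ 0 _ m); split=> // j Aj.
  by rewrite leEnat; apply/minm/asboolP.
by move=> [Ar lbr]; split=> // j /lbr; rewrite leEnat.
Qed.

(** Only the elements of [P] and their proper multiples are removed, and a
    prime is a proper multiple [p * b], with [b > 1], of no [p > 1]. *)
Lemma prime_survivor (P : {fset nat}) (q : nat) :
  (forall p, p \in P -> 1 < p) -> prime q -> q \notin P -> survivors P q.
Proof.
move=> P_gt1 q_pr qP; split; first exact: prime_gt1.
move=> [/= qP'|[p /= pP [b b_gt1 pbq]]]; first by rewrite qP' in qP.
have [_] := (primeNfactor q).1 q_pr; apply.
by exists p, b; split=> //; apply: P_gt1.
Qed.

(** If [p = pdiv n] were in [P], then [n = p * b] would be removed, either as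
    [p] itself or as a proper multiple of [p], according to whether [b = 1]. *)
Lemma survivor_pdiv (P : {fset nat}) (n : nat) :
  survivors P n -> pdiv n \notin P.
Proof.
move=> [/= n_gt1 nPC]; apply/negP => pP; apply: nPC.
have nE : n %/ pdiv n * pdiv n = n by rewrite divnK// pdiv_dvd.
case: (ltngtP (n %/ pdiv n) 1) => [b0|b1|b1].
- by move: b0 nE n_gt1; rewrite ltnS leqn0 => /eqP -> /= <-.
- by right; exists (pdiv n) => //; exists (n %/ pdiv n) => //; rewrite mulnC.
- by left; rewrite /= -nE b1 mul1n.
Qed.

Lemma prime_notin_fset (P : {fset nat}) : exists2 q, prime q & q \notin P.
Proof.
have [q q_gt q_pr] := prime_above (\max_(p <- P) p).
exists q => //; apply/negP => qP; move: q_gt.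
by rewrite ltnNge (@leq_bigmax_seq _ _ predT id).
Qed.

Section LeastSurvivor.
Variable P : {fset nat}.
Hypothesis P_pr : forall p, p \in P -> prime p.
Let r := set_min (survivors P).

Let P_gt1 (p : nat) : p \in P -> 1 < p.
Proof. by move=> /P_pr /prime_gt1. Qed.

Lemma survivors_neq0 : survivors P !=set0.
Proof.
have [q q_pr qP] := prime_notin_fset P.
by exists q; apply: prime_survivor.
Qed.

Lemma prime_least_survivor : prime r.
Proof.
have [Sr r_min] := set_minP _ survivors_neq0.
have r_gt1 : 1 < r by case: Sr.
have le_r : r <= pdiv r.
  by apply/r_min/prime_survivor/survivor_pdiv => //; apply: pdiv_prime.
suff -> : r = pdiv r by apply: pdiv_prime.
by apply/eqP; rewrite eqn_leq le_r pdiv_leq// ltnW.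
Qed.

Lemma least_survivor_notin : r \notin P.
Proof.
have [[_ rPC] _] := set_minP _ survivors_neq0.
by apply/negP => rP; apply: rPC; left.
Qed.

Lemma prime_lt_least_survivor (q : nat) : prime q -> q < r -> q \in P.
Proof.
move=> q_pr; apply: contraTT => qP; rewrite -leqNgt.
have [_] := set_minP _ survivors_neq0; apply.
exact: prime_survivor.
Qed.

End LeastSurvivor.

Section InitialSegment.
Variables (k : nat) (P : {fset nat}).
Hypothesis first_P : first_primes k P.
Let r := set_min (survivors P).

Let P_pr (p : nat) : p \in P -> prime p.
Proof. by case: first_P => _ + _; apply. Qed.

(** Otherwise [r] would be a prime below an element of the initial segment
    [P], hence in [P]. *)
Lemma lt_least_survivor (p : nat) : p \in P -> p < r.
Proof.
move=> pP; have [_ _ P_init] := first_P.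
have rP : r \notin P := least_survivor_notin _ P_pr.
rewrite ltnNge leq_eqVlt; apply/negP => /orP[/eqP rp|rp].
  by rewrite rp pP in rP.
have r_pr : prime r := prime_least_survivor _ P_pr.
by rewrite (P_init p) in rP.
Qed.

Lemma first_primesS : first_primes k.+1 (P `|` [fset r])%fset.
Proof.
have [cardP _ P_init] := first_P; split.
- by rewrite fsetUC cardfsU1 (least_survivor_notin _ P_pr) cardP.
- by move=> p /fsetUP[/P_pr//|/fset1P ->]; apply: prime_least_survivor.
- move=> p q /fsetUP[pP|/fset1P ->] q_pr qp; apply/fsetUP; left.
    exact: (P_init p).
  exact: prime_lt_least_survivor.
Qed.

End InitialSegment.

(** An initial segment of the primes with largest element [p] has the same
    members as the duplicate-free list of the primes up to [p]. *)
Lemma count_first_primes (k : nat) (A : {fset nat}) (p : nat) :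
  first_primes k A -> p \in A -> (forall q, q \in A -> q <= p) ->
  count prime (iota 0 p.+1) = k.
Proof.
move=> [<- A_pr A_init] pA A_le; rewrite -size_filter.
apply/perm_size/uniq_perm; rewrite ?filter_uniq ?iota_uniq ?fset_uniq// => q.
rewrite mem_filter mem_iota /= add0n ltnS.
apply/andP/idP => [[q_pr]|qA]; last by split; [exact: A_pr|exact: A_le].
by rewrite leq_eqVlt => /orP[/eqP -> //|]; exact: A_init.
Qed.

Lemma first_primes_sieve (k : nat) : first_primes k (sieve k).
Proof.
by elim: k => [|k IHk]; [split; rewrite ?cardfs0|exact: first_primesS].
Qed.

Theorem theorem4p5p2 (k : nat) :
  [/\ survivors (sieve k) !=set0,
      survivors (sieve k) (least_survivor k) /\
        (forall n : nat, survivors (sieve k) n -> least_survivor k <= n),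
      prime (least_survivor k),
      first_primes k (sieve k)
    & nth_prime k.+1 (least_survivor k)].
Proof.
have first_k := first_primes_sieve k.
have [_ sieve_pr _] := first_k.
have r_pr := prime_least_survivor _ sieve_pr.
have S_neq0 := survivors_neq0 _ sieve_pr.
split=> //; first exact: set_minP.
split=> //; apply: count_first_primes (first_primes_sieve k.+1) _ _ => /=.
  by apply/fsetUP; right; apply/fset1P.
move=> q /fsetUP[qP|/fset1P -> //].
exact/ltnW/(lt_least_survivor _ _ first_k).
Qed.
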